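(* Let $X$ be a set, let $Y$ be a nonempty subset of $X$, and let $\mathbb{S}(Y)$ be a subsemigroup of $T(Y)$. Then $T_{\mathbb{S}(Y)}(X)$ is an inverse semigroup if and only if both of the following hold: (i) $\mathbb{S}(Y)$ is an inverse semigroup; (ii) either $Y=X$ or $|X|=2$.
   Context: Semigroups (hence subsemigroups) are nonempty. For a set $A$, $T(A)$ is the semigroup of all maps $A\to A$ under composition (composed from left to right, with $xf$ denoting the image of $x$ under $f$). For $f\in T(X)$ with $Yf\subseteq Y$, $f_{\upharpoonright_Y}\in T(Y)$ denotes the map $Y\to Y$ that agrees with $f$ on $Y$. Define $T_{\mathbb{S}(Y)}(X)=\{f\in T(X) : Yf\subseteq Y \text{ and } f_{\upharpoonright_Y}\in\mathbb{S}(Y)\}$, a subsemigroup of $T(X)$. A semigroup $S$ is an inverse semigroup if for every $x\in S$ there is a unique $y\in S$ with $xyx=x$ and $yxy=y$. *)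

(* Defs.v *)
From HB Require Import structures.
From mathcomp Require Import all_boot.
From mathcomp Require Import boolp classical_sets functions.

Set Implicit Arguments.
Unset Strict Implicit.
Unset Printing Implicit Defensive.

Local Open Scope classical_set_scope.
Local Open Scope group_scope.

Definition transf (A : Type) : Type := A -> A.

HB.instance Definition _ (A : Type) := gen_eqMixin (transf A).
HB.instance Definition _ (A : Type) := gen_choiceMixin (transf A).

(* Maps are composed from left to right: [(f \; g) x = g (f x)]. *)
Definition transf_mul (A : Type) (f g : transf A) : transf A := f \; g.

Lemma transf_mulA (A : Type) : associative (@transf_mul A).
Proof. by []. Qed.

HB.instance Definition _ (A : Type) :=
  isSemigroup.Build (transf A) (@transf_mulA A).

Definition subsemigroup (G : semigroupType) (S : set G) : Prop :=
  S !=set0 /\ forall x y : G, S x -> S y -> S (x * y).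

(* Inverses are sought, and unique, within S rather than in the ambient G. *)
Definition inverse_semigroup (G : semigroupType) (S : set G) : Prop :=
  subsemigroup S /\
  forall x : G, S x ->
    exists! y : G, [/\ S y, x * y * x = x & y * x * y = y].

Definition restr (X : Type) (Y : set X) (f : transf X)
    (fY : set_fun Y Y f) : transf Y :=
  sigLR (mkfun_fun fY).

Definition transf_over (X : Type) (Y : set X) (SY : set (transf Y)) :
    set (transf X) :=
  [set f | exists fY : set_fun Y Y f, SY (restr fY)].

(* Main.v *)
(** Extending by the identity embeds [SY] into [transf_over SY], and restriction
    to [Y] is a left inverse, so regularity and uniqueness of inverses descend
    to [SY].  Assume now [Y <> X].  For an idempotent [e] of [SY], regularity of
    the maps that act as [e] on [Y] and are constant off [Y] forces [e = id].
    The maps [k_c] that fix [Y] pointwise and send its complement to [c] then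
    form a left-zero band for [c] in [Y] and a right-zero band for [c] outside
    [Y]; distinct elements of such a band are mutually inverse, so uniqueness of
    inverses makes both [Y] and its complement singletons. *)

Require Import Defs.
From mathcomp Require Import all_boot.
From mathcomp Require Import boolp classical_sets functions cardinality.

Set Implicit Arguments.
Unset Strict Implicit.
Unset Printing Implicit Defensive.

Local Open Scope classical_set_scope.
Local Open Scope card_scope.

(** Trades the stability proof inside [restr] for a pointwise equation in [X], so that members can
    be built and taken apart without dependent types. *)
Lemma transf_overE (X : Type) (Y : set X) (SY : set (transf Y))
    (f : transf X) :
  transf_over SY f <->
  exists2 s : transf Y, SY s & forall y : Y, f (val y) = val (s y).
Proof.
split=> [[fY Ss]|[s Ss sE]].
  by exists (restr fY).
have fY : set_fun Y Y f.
  move=> x /mem_set Yx; have /= -> := sE (Sub x Yx).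
  exact/set_mem/valP.
exists fY; suff -> : restr fY = s by [].
by apply/funext => y; apply/val_inj; rewrite -sE.
Qed.

Lemma eq_transf_on (X : Type) (Y : set X) (f g : transf X) :
  (forall y : Y, f (val y) = g (val y)) ->
  (forall x, ~ Y x -> f x = g x) -> f = g.
Proof.
move=> fgY fgN; apply/funext => x.
have [Yx|] := pselect (Y x); last exact: fgN.
exact: (fgY (Sub x (mem_set Yx))).
Qed.

(** The values off [Y] are a parameter: [id] makes extension multiplicative, and constant maps
    supply the test elements for [Y <> [set: X]]. *)
Definition extend (X : Type) (Y : set X) (d : transf X) (s : transf Y) :
    transf X :=
  fun x => if insub x is Some y then val (s y) else d x.

Section Extend.
Context {X : Type} {Y : set X}.
Implicit Types (d f : transf X) (s t : transf Y).

Lemma extend_val d s (y : Y) : extend d s (val y) = val (s y).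
Proof. by rewrite /extend valK. Qed.

Lemma extend_out d s x : ~ Y x -> extend d s x = d x.
Proof. by move=> nYx; rewrite /extend insubN// notin_setE. Qed.

Lemma extend_inj d : injective (@extend X Y d).
Proof.
move=> s t est; apply/funext => y; apply/val_inj.
by rewrite -!(extend_val d) est.
Qed.

Lemma extend_id_mul s t :
  extend id (s * t)%g = (extend id s * extend id t)%g.
Proof.
apply: (@eq_transf_on _ Y) => [y|x nYx].
  by rewrite -[RHS]/(extend _ _ (extend _ _ _)) !extend_val.
by rewrite -[RHS]/(extend _ _ (extend _ _ _)) !extend_out.
Qed.

Lemma transf_over_extend (SY : set (transf Y)) d s :
  SY s -> transf_over SY (extend d s).
Proof. by move=> Ss; apply/transf_overE; exists s => // y; exact: extend_val. Qed.

Lemma transf_over_subsemigroup (SY : set (transf Y)) :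
  subsemigroup SY -> subsemigroup (transf_over SY).
Proof.
move=> [[s Ss] SM]; split; first by exists (extend id s); exact: transf_over_extend.
move=> f g /transf_overE[a Sa fa] /transf_overE[b Sb gb].
apply/transf_overE; exists (a * b)%g; first exact: SM.
by move=> y; rewrite -[LHS]/(g (f _)) fa gb.
Qed.

End Extend.

(** Equations between images pull back along the injective [phi], so uniqueness of inverses
    transfers too. It is meant for [phi := extend id] when [Y = [set: X]]. *)
Lemma inverse_semigroup_image (G H : semigroupType) (phi : G -> H)
    (S : set G) :
  injective phi -> {morph phi : x y / (x * y)%g} ->
  inverse_semigroup S -> inverse_semigroup (phi @` S).
Proof.
move=> phiI phiM [[[s Ss] SM] Sinv]; split; first split.
- by exists (phi s), s.
- move=> _ _ [x Sx <-] [y Sy <-]; rewrite -phiM.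
  by exists (x * y)%g => //; exact: SM.
move=> _ [x Sx <-]; have [y [[Sy xyx yxy] yuniq]] := Sinv x Sx.
exists (phi y); split; first by rewrite -!phiM xyx yxy; split=> //; exists y.
move=> _ [[z Sz <-]]; rewrite -!phiM => /phiI xzx /phiI zxz.
by rewrite (yuniq z).
Qed.

Lemma transf_over_setT (X : Type) (Y : set X) (SY : set (transf Y)) :
  Y = [set: X] -> transf_over SY = extend id @` SY.
Proof.
move=> YT; apply/seteqP; split=> [f|_ [s Ss <-]]; last first.
  exact: transf_over_extend.
move=> /transf_overE[s Ss fs]; exists s => //.
by apply: (@eq_transf_on _ Y) => [y|x []]; [rewrite extend_val fs | rewrite YT].
Qed.

Lemma inverse_transf_over_restr (X : Type) (Y : set X) (SY : set (transf Y)) :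
  subsemigroup SY ->
  inverse_semigroup (transf_over SY) -> inverse_semigroup SY.
Proof.
move=> SYsub [_ Tinv]; split=> // s Ss.
have [g [[/transf_overE[t St gt] sgs gsg] guniq]] :=
  Tinv _ (transf_over_extend id Ss).
exists t; split.
  split=> //; apply/funext => y; apply/val_inj.
    have : extend id s (g (extend id s (val y))) = extend id s (val y).
      exact: (congr1 (@^~ (val y)) sgs).
    by rewrite !extend_val gt extend_val.
  have : g (extend id s (g (val y))) = g (val y).
    exact: (congr1 (@^~ (val y)) gsg).
  by rewrite gt extend_val gt.
(* An inverse [u] of [s] extends to an inverse of [extend id s], hence to [g], whose restriction to
   [Y] is [t]. *)
move=> u [Su sus usu]; have gu : g = extend id u.
  apply: guniq; rewrite -!extend_id_mul sus usu; split=> //.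
  exact: transf_over_extend.
by apply/funext => y; apply/val_inj; rewrite -gt gu extend_val.
Qed.

Lemma inverse_transf_over_id (X : Type) (Y : set X) (SY : set (transf Y)) :
  subsemigroup SY -> Y <> [set: X] ->
  inverse_semigroup (transf_over SY) -> SY (id : transf Y).
Proof.
move=> SYsub YT Tinv.
have [[[s Ss] SM] Sinv] := inverse_transf_over_restr SYsub Tinv.
have [b nYb] : exists b, ~ Y b by exact/setTPn/eqP.
have [t [[St sts _] _]] := Sinv _ Ss.
pose e : transf Y := (s * t)%g.
have Se : SY e by exact: SM.
have ee y : e (e y) = e y by rewrite -[RHS]/(t (s y)) -sts.
suff eid : e = id by rewrite -eid.
apply/funext => y.
(* Regularity of the map acting as [e] on [Y] and sending the rest of [X] to
   [y] forces [y] into the image of the idempotent [e]. *)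
pose k : transf X := extend (fun=> val y) e.
have [g [[/transf_overE[u _ gu] kgk _] _]] :=
  Tinv.2 k (transf_over_extend _ Se).
have : k (g (k b)) = k b by exact: (congr1 (@^~ b) kgk).
rewrite /k (extend_out _ _ nYb)// gu extend_val => /val_inj <-.
exact: ee.
Qed.

Lemma inverse_transf_over_eq (X : Type) (Y : set X) (SY : set (transf Y))
    (c d : X) :
  Y <> [set: X] -> SY (id : transf Y) ->
  inverse_semigroup (transf_over SY) -> (Y c <-> Y d) -> c = d.
Proof.
move=> YT Sid [_ Tinv] Ycd.
have [b nYb] : exists b, ~ Y b by exact/setTPn/eqP.
pose k (a : X) : transf X := extend (fun=> a) (id : transf Y).
have Tk a : transf_over SY (k a) by exact: transf_over_extend.
have kY a (y : Y) : k a (val y) = val y by exact: extend_val.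
have kN a x : ~ Y x -> k a x = a by exact: extend_out.
(* Off [Y] the first factor gives [a]. If [a] lies in [Y], the later factors fix it; otherwise each
   factor overwrites the value and the last one restores [a]. *)
have kkk a a' : (Y a <-> Y a') -> (k a * k a' * k a)%g = k a.
  move=> Yaa'; apply: (@eq_transf_on _ Y) => [y|x nYx].
    by rewrite -[LHS]/(k a (k a' (k a _))) !kY.
  rewrite -[LHS]/(k a (k a' (k a _))) !(kN a x)//.
  have [Ya|nYa] := pselect (Y a).
    by rewrite -[a in k a' a]/(val (Sub a (mem_set Ya) : Y)) !kY.
  by rewrite (kN a' a)// kN// -Yaa'.
have [g [_ guniq]] := Tinv (k c) (Tk c).
(* Both [k c] and [k d] are inverses of [k c], so both equal [g]; evaluation at [b] then compares
   [c] with [d]. *)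
have kcd : k c = k d.
  rewrite -(guniq (k c)); last by split=> //; apply: kkk.
  by apply: guniq; split=> //; apply: kkk => //; exact: iff_sym.
by rewrite -(kN c b)// kcd kN.
Qed.

Lemma card_eq_I2P (X : Type) :
  [set: X] #= `I_2 <->
  exists a b : X, a <> b /\ forall x, x = a \/ x = b.
Proof.
split=> [/card_set_bijP[f [fI finj fsurj]]|[a [b [ab abT]]]].
  have [a _ fa] : exists2 a, [set: X] a & f a = 0 by exact: fsurj.
  have [b _ fb] : exists2 b, [set: X] b & f b = 1 by exact: fsurj.
  exists a, b; split=> [ab|x]; first by rewrite ab fb in fa.
  have fx : f x < 2 by exact: fI.
  case fxE : (f x) fx => [|[|//]] _; [left | right].
    by apply: finj; rewrite ?in_setT// fxE.
  by apply: finj; rewrite ?in_setT// fxE.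
have ba : b <> a by move=> /esym.
apply/card_set_bijP; exists (fun x => if `[< x = a >] then 0 else 1); split.
- by move=> x _ /=; case: ifP.
- move=> x y _ _; have [->|->] := abT x; have [->|->] := abT y;
    by rewrite ?(asboolT (erefl a)) ?(asboolF ba).
- move=> [|[|//]] _; first by exists a => //; rewrite asboolT.
  by exists b => //; rewrite asboolF.
Qed.

(** Here [Y] is the singleton of [a], so each member fixes [a] and is either the identity or
    constant at [a]. Both are idempotent, hence their own inverses. *)
Lemma inverse_transf_over_set2 (X : Type) (Y : set X) (SY : set (transf Y))
    (a b : X) :
  subsemigroup SY -> Y a -> ~ Y b -> (forall x, x = a \/ x = b) ->
  inverse_semigroup (transf_over SY).
Proof.
move=> SYsub Ya nYb abT; split; first exact: transf_over_subsemigroup.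
have ba : b <> a by move=> ba; rewrite ba in nYb.
have Tfix f : transf_over SY f -> f a = a.
  move=> /transf_overE[s _ fs]; have := fs (Sub a (mem_set Ya)); rewrite /= => ->.
  case: (abT (val (s (Sub a (mem_set Ya))))) => // sb.
  by case: nYb; rewrite -sb; exact/set_mem/valP.
have eqT (f g : transf X) : f a = g a -> f b = g b -> f = g.
  by move=> fga fgb; apply/funext => x; have [->|->] := abT x.
move=> f Tf; have fa := Tfix f Tf; exists f.
have fff : (f * f * f)%g = f.
  apply: eqT; rewrite -[LHS]/(f (f (f _))) ?fa//.
  by have [fb|fb] := abT (f b); rewrite !fb ?fa ?fb.
split=> // g [Tg fgf gfg]; have ga := Tfix g Tg.
have fgfb : f (g (f b)) = f b by exact: (congr1 (@^~ b) fgf).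
have gfgb : g (f (g b)) = g b by exact: (congr1 (@^~ b) gfg).
apply: eqT; first by rewrite fa ga.
(* If one map is the identity and the other constant, the inverse equation for the identity, taken
   at [b], yields [a = b]. *)
have [fb|fb] := abT (f b); have [gb|gb] := abT (g b); rewrite fb gb //.
  by rewrite gb fb ga in gfgb.
by rewrite fb gb fa in fgfb.
Qed.

Theorem theorem3p4 (X : Type) (Y : set X) (SY : set (transf Y))
    (Y_nonempty : Y !=set0) (SY_sub : subsemigroup SY) :
  inverse_semigroup (transf_over SY) <->
  inverse_semigroup SY /\ (Y = [set: X] \/ [set: X] #= `I_2).
Proof.
have [YT|YT] := pselect (Y = [set: X]).
  split=> [Tinv|[Sinv _]].
    by split; [exact: inverse_transf_over_restr Tinv | left].
  rewrite transf_over_setT//; apply: inverse_semigroup_image => //.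
    exact: extend_inj.
  exact: extend_id_mul.
have [b nYb] : exists b, ~ Y b by exact/setTPn/eqP.
have [a Ya] := Y_nonempty.
split=> [Tinv|[_ [//|/card_eq_I2P[c [d [_ cdT]]]]]].
  split; first exact: inverse_transf_over_restr Tinv.
  right; apply/card_eq_I2P; exists a, b; split=> [ab|x].
    by rewrite -ab in nYb.
  have Sid := inverse_transf_over_id SY_sub YT Tinv.
  by have [Yx|nYx] := pselect (Y x); [left|right];
     apply: (inverse_transf_over_eq YT Sid Tinv); split.
apply: (inverse_transf_over_set2 SY_sub Ya nYb) => x.
(* Only [a] lies in [Y], so [a] and [b] are distinct and exhaust the two points [c] and [d]. *)
case: (cdT a) (cdT b) (cdT x) => [?|?] [?|?] [?|?]; subst; tauto.
Qed.
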